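(* Let $G$ be an additive abelian group of order $n$ and suppose $\{A_1,\dots,A_m\}$ is an $(n,m;k_1,\dots,k_m;\lambda_1,\dots,\lambda_m)$-generalized strong external difference family in $G$, where $m\geq 3$. Let $\Lambda=\lambda_1+\cdots+\lambda_m$ and $K=k_1+\cdots+k_m$. Then for any $i\in\{1,\dots,m\}$ for which $k_i>\lambda_i>1$ and $\lambda_i\leq \frac{\Lambda}{2}$, \[ \frac{(k_i-1)(\Lambda-2\lambda_i)}{(K-k_i)(\lambda_i-1)}\leq 1. \]
   Context: For disjoint subsets $A,B$ of an additive abelian group $G$, let $\mathcal{D}(A,B)$ denote the multiset $\{x-y : x\in A,\ y\in B\}$. An $(n,m;k_1,\dots,k_m;\lambda_1,\dots,\lambda_m)$-generalized strong external difference family (GSEDF) in an additive abelian group $G$ of order $n$ is a set of $m$ pairwise disjoint subsets $A_1,\dots,A_m$ of $G$ with $|A_i|=k_i$ for $1\le i\le m$, such that for every $i$ the multiset union $\bigcup_{j\neq i}\mathcal{D}(A_i,A_j)$ contains every nonzero element of $G$ exactly $\lambda_i$ times. *)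

(* Defs.v *)
From mathcomp Require Import all_boot all_algebra.
From mathcomp Require Import finmap multiset.

Set Implicit Arguments.
Unset Strict Implicit.
Unset Printing Implicit Defensive.

Import GRing.Theory.

Local Open Scope ring_scope.

(* Differences are counted with multiplicity: one copy of x - y per pair. *)
Definition diff_mset (G : finZmodType) (A B : {set G}) : {mset G}%mset :=
  seq_mset [seq x - y | x <- enum A, y <- enum B].

(* The union of multisets is the additive one, msetD (multiplicities add up);
   a multiset applied to g is the multiplicity of g. Sets are indexed by
   'I_m, i.e. by 0, ..., m - 1 rather than 1, ..., m. *)
Definition is_GSEDF (G : finZmodType) (n m : nat) (k lambda : 'I_m -> nat)
    (A : 'I_m -> {set G}) : Prop :=
  [/\ #|G| = n,
      forall i j : 'I_m, i != j -> [disjoint A i & A j],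
      forall i : 'I_m, #|A i| = k i
    & forall (i : 'I_m) (g : G), g != 0 ->
        (\big[msetD/mset0]_(j < m | j != i) diff_mset (A i) (A j)) g
          = lambda i].

(* Main.v *)
(** Let B be the union of the A_j with j <> i, and let g <> 0. Splitting off
    A_i from the differences counted by Lambda, the pairs in A_i x B and in
    B x A_i give lambda_i each and the others lie in B x B, so g is a
    difference of B at least Lambda - 2 lambda_i times. On the other hand,
    the sets a - B with a in A_i cover every nonzero element exactly lambda_i
    times, and a - B and a' - B meet in as many points as a' - a has
    representations in B - B. For fixed a, counting the points of a - B by the
    lambda_i - 1 other sets containing them yields
    (k_i - 1) (Lambda - 2 lambda_i) <= (K - k_i) (lambda_i - 1). *)
Require Import Defs.
From mathcomp Require Import all_boot all_order all_algebra.
From mathcomp Require Import finmap multiset zify.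
Import GRing.Theory Num.Theory.

Local Open Scope ring_scope.

Lemma big_msetDE (K : choiceType) (I : Type) (r : seq I) (P : pred I)
    (F : I -> {mset K}%mset) (a : K) :
  (\big[msetD/mset0]_(i <- r | P i) F i)%mset a
    = (\sum_(i <- r | P i) F i a)%N.
Proof. by elim/big_rec2: _ => [|i y x _ <-]; rewrite ?mset0E // msetE2. Qed.

Lemma sum_bigcup (T I : finType) (P : pred I) (A : I -> {set T})
    (F : T -> nat) :
  (forall i j, i != j -> [disjoint A i & A j]) ->
  (\sum_(x in \bigcup_(i | P i) A i) F x = \sum_(i | P i) \sum_(x in A i) F x)%N.
Proof.
move=> dA.
(* Emptying the sets outside [P] makes the union unfiltered and keeps the family disjoint. *)
have -> : \bigcup_(i | P i) A i = \bigcup_i (if P i then A i else set0).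
  exact: big_mkcond.
rewrite partition_disjoint_bigcup => [|i j ne_ij].
  by rewrite [RHS]big_mkcond; apply: eq_bigr => i _; case: (P i); rewrite ?big_set0.
by case: (P i); case: (P j); rewrite ?dA // -setI_eq0 ?set0I ?setI0.
Qed.

Section Differences.
Variable G : finZmodType.
Implicit Types (X Y : {set G}) (g : G).

Lemma diff_msetE X Y g :
  diff_mset X Y g = (\sum_(x in X) \sum_(y in Y) ((x - y)%R == g))%N.
Proof.
rewrite /diff_mset mset_seqE -sum1_count big_mkcond big_allpairs_dep big_enum.
apply: eq_bigr => x _; rewrite big_enum /=.
by apply: eq_bigr => y _; case: eqP.
Qed.

Lemma diff_mset_mem X Y g :
  diff_mset X Y g = (\sum_(x in X) ((x - g)%R \in Y))%N.
Proof.
rewrite diff_msetE; apply: eq_bigr => x _.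
under eq_bigr => y _ do rewrite subr_eq addrC -subr_eq eq_sym.
have [gY|gY] := boolP (x - g \in Y).
  by rewrite (bigD1 (x - g)) //= eqxx big1 // => y /andP[_ /negPf->].
by rewrite big1 // => y yY; case: eqP gY => // <-; rewrite yY.
Qed.

Lemma diff_msetN X Y g : diff_mset X Y (- g) = diff_mset Y X g.
Proof.
rewrite !diff_msetE exchange_big; apply: eq_bigr => y _ /=.
by apply: eq_bigr => x _; rewrite -eqr_opp opprB opprK.
Qed.

Lemma diff_mset_bigcup (I J : finType) (P : pred I) (Q : pred J)
    (A : I -> {set G}) (B : J -> {set G}) g :
  (forall i j, i != j -> [disjoint A i & A j]) ->
  (forall i j, i != j -> [disjoint B i & B j]) ->
  diff_mset (\bigcup_(i | P i) A i) (\bigcup_(j | Q j) B j) g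
    = (\sum_(i | P i) \sum_(j | Q j) diff_mset (A i) (B j) g)%N.
Proof.
move=> dA dB; rewrite diff_msetE sum_bigcup //; apply: eq_bigr => i _.
under [RHS]eq_bigr => j _ do rewrite diff_msetE.
by rewrite [RHS]exchange_big; apply: eq_bigr => x _; rewrite sum_bigcup.
Qed.

(** A representation y' - y of x' - x in [Y] is an equality x - y = x' - y'. For fixed y,
    disjointness makes x - y nonzero, so it lies in x' - Y for exactly [l] elements x' of [X]. One
    of these is [x] itself, hence [l.-1]. *)
Lemma sum_translate_inter X Y (l : nat) x :
  [disjoint X & Y] -> (forall g, g != 0 -> diff_mset X Y g = l) -> x \in X ->
  (\sum_(x' in X | x' != x) diff_mset Y Y (x' - x)%R = #|Y| * l.-1)%N.
Proof.
move=> dXY hl xX.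
under eq_bigr => x' _ do rewrite -diff_msetN opprB diff_mset_mem.
rewrite exchange_big /= -sum_nat_const; apply: eq_bigr => y yY.
have ne : x - y != 0.
  by rewrite subr_eq0; apply: contraTneq xX => ->; rewrite (disjointFl dXY).
rewrite -(hl _ ne) diff_mset_mem [in RHS](bigD1 x) //= subKr yY add1n /=.
by apply: eq_bigr => z _; rewrite !opprB addrCA.
Qed.

End Differences.

Theorem theorem5p2 (G : finZmodType) (n m : nat) (k lambda : 'I_m -> nat)
    (A : 'I_m -> {set G}) (hm : (3 <= m)%N)
    (hA : is_GSEDF n k lambda A) (i : 'I_m) :
  let Lambda : nat := (\sum_(j < m) lambda j)%N in
  let K : nat := (\sum_(j < m) k j)%N in
  (lambda i < k i)%N -> (1 < lambda i)%N ->
  (lambda i)%:R <= Lambda%:R / 2 :> rat ->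
  (((k i)%:R - 1) * (Lambda%:R - 2 * (lambda i)%:R))
    / ((K%:R - (k i)%:R) * ((lambda i)%:R - 1)) <= 1 :> rat.
Proof.
move=> Lambda K ltlk lt1l _.
have [_ dA cA lA] := hA.
pose B := \bigcup_(j | j != i) A j.
have lAE j g : g != 0 ->
    (\sum_(l | l != j) diff_mset (A j) (A l) g)%N = lambda j.
  by move=> g0; rewrite -(lA j g g0) big_msetDE.
have lB g : g != 0 -> diff_mset (A i) B g = lambda i.
  move=> g0; rewrite -(lAE i g g0).
  (* [A i] is read as the union over the singleton index set [pred1 i]. *)
  have := @diff_mset_bigcup G _ _ (pred1 i) (predC1 i) A A g dA dA.
  by rewrite !big_pred1_eq.
have dAB : [disjoint A i & B].
  by apply/bigcup_disjointP => j ji; rewrite dA // eq_sym.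
have cB : (#|B| + k i)%N = K.
  rewrite -sum1_card sum_bigcup // /K [in RHS](bigD1 i) //= addnC; congr addn.
  by apply: eq_bigr => j _; rewrite sum1_card cA.
have BB g : g != 0 -> (Lambda <= 2 * lambda i + diff_mset B B g)%N.
  move=> g0; rewrite diff_mset_bigcup // /Lambda (bigD1 i) //= mul2n -addnn -addnA.
  (* One [lambda i] has cancelled against the [i] term of [Lambda]. The other, expanded at [- g],
     supplies for each j the differences from [A j] to [A i]; those from [A j] to [A l] with l
     distinct from i and j occur in [B]. *)
  rewrite leq_add2l -{1}(lAE i (- g)) ?oppr_eq0 // -big_split leq_sum //= => j ji.
  rewrite -(lAE j g) // (bigD1 i) 1?eq_sym //= diff_msetN leq_add2l.
  rewrite [leqLHS]big_mkcond [leqRHS]big_mkcond leq_sum //= => l _.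
  by case: (l == i); rewrite ?andbF // andbT; case: (l == j).
have [x xA] : exists x, x \in A i by apply/card_gt0P; rewrite cA; lia.
(* This sums [BB] at x' - x over the x' in [A i] other than [x]. The term in [2 * lambda i] stays on
   the right to avoid truncated subtraction. *)
have key : ((k i).-1 * Lambda <= (k i).-1 * (2 * lambda i) + #|B| * (lambda i).-1)%N.
  rewrite -(@sum_translate_inter G _ _ _ x dAB lB xA).
  have -> : (k i).-1 = (\sum_(x' in A i | x' != x) 1)%N.
    by rewrite -cA -sum1_card (bigD1 x).
  rewrite !big_distrl -big_split leq_sum //= => y /andP[_ yx].
  by rewrite !mul1n BB // subr_eq0.
rewrite -cB natrD addrK.
(* If B is empty, the quotient is a division by zero, hence 0. *)
have [->|Bpos] := posnP #|B|; first by rewrite mul0r invr0 mulr0.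
have E p : (0 < p)%N -> p%:R - 1 = p.-1%:R :> rat by case: p => // p _; rewrite -natr1 addrK.
rewrite !E //; try lia.
rewrite ler_pdivrMr; last by rewrite -natrM ltr0n muln_gt0 Bpos; lia.
by rewrite mul1r mulrBr lerBlDl -!natrM -natrD ler_nat.
Qed.
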